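(* Let $a$ be one of $\mathsf{m}$, $\mathrm{ems}$, $\mathrm{ess}$, $\mathrm{ms}\neg\multimap$, $\mathrm{ss}\neg\multimap$. Then the relation $\to_a$ is strongly normalizing on all (untyped) terms of the exponential substitution calculus, i.e. there is no infinite $\to_a$-reduction sequence starting from any term.
   Context: Exponential substitution calculus (ESC). Variables come in two disjoint countably infinite kinds: multiplicative variables $m,n,o,\ldots$ and exponential variables $e,f,g,\ldots$; $x,y,z$ denote variables of either kind. Multiplicative values $v_{\mathsf m} ::= m \mid (t,s) \mid \lambda x.t$; exponential values $v_{\mathsf e} ::= e \mid\ !t$; values $v ::= v_{\mathsf m}\mid v_{\mathsf e}$. Terms: $t,s,u ::= v \mid \mathsf{cut}(v,x.t) \mid \mathsf{par}(m,x.y.t) \mid \mathsf{sub}(m,v,x.t) \mid \mathsf{der}(e,x.t)$ (cut, par, subtraction, dereliction; note the first argument of cut and the second of subtraction must be values). In $\lambda x.t$, $\mathsf{cut}(v,x.t)$, $\mathsf{sub}(m,v,x.t)$, $\mathsf{der}(e,x.t)$ the variable $x$ is bound in $t$; in $\mathsf{par}(m,x.y.t)$ both $x,y$ are bound in $t$; terms are identified up to $\alpha$-renaming; $\mathrm{fv}(t)$ denotes free variables. Left contexts: $L ::= \langle\cdot\rangle \mid \mathsf{cut}(v,x.L)\mid\mathsf{par}(m,x.y.L)\mid\mathsf{sub}(m,v,x.L)\mid\mathsf{der}(e,x.L)$; every term $t$ is uniquely $t=L\langle v\rangle$. Value contexts $V ::= \langle\cdot\rangle \mid (C,s)\mid (t,C)\mid\lambda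 x.C\mid\ !C$; general contexts $C ::= V \mid \mathsf{cut}(V,x.t)\mid\mathsf{sub}(m,V,x.t)\mid L\langle C\rangle$; multiplicative value contexts $V_{\mathsf m} ::= \langle\cdot\rangle\mid (M,s)\mid(t,M)\mid\lambda x.M$; multiplicative contexts $M ::= V_{\mathsf m}\mid \mathsf{cut}(V_{\mathsf m},x.t)\mid \mathsf{sub}(m,V_{\mathsf m},x.t)\mid L\langle M\rangle$ (hole not under any $!$). Plugging $C\langle t\rangle$ replaces the hole by $t$ (possibly capturing variables), except that when the hole is directly the value of a cut or subtraction, the left context is extracted: if $t=L\langle v\rangle$ then $\mathsf{cut}(\langle\cdot\rangle,x.s)\langle t\rangle := L\langle\mathsf{cut}(v,x.s)\rangle$ and $\mathsf{sub}(m,\langle\cdot\rangle,x.s)\langle t\rangle := L\langle\mathsf{sub}(m,v,x.s)\rangle$. $C\langle\!\langle t\rangle\!\rangle$ is plugging with renaming of bound variables of $C$ so that no free variable of $t$ is captured. Meta-level substitution $\{v_{\mathsf e}/e\}t$ (capture-avoiding) commutes with all constructors, is the identity on variables other than $e$, sets $\{v_{\mathsf e}/e\}e := v_{\mathsf e}$, and on derelictions on $e$: $\{f/e\}\mathsf{der}(e,x.t) := \mathsf{der}(f,x.\{f/e\}t)$ and $\{!L\langle v\rangle/e\}\mathsf{der}(e,x.t) := L\langle \mathsf{cut}(v,x.\{!L\langle v\rangle/e\}t)\rangle$. For multiplicative $m,n$, $\{n/m\}t$ is renaming. Root rules (the context $M$ or $C$ does not capture the cut variable $m$ or $e$): (ax$_{m1}$)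 $\mathsf{cut}(v_{\mathsf m},m.M\langle\!\langle m\rangle\!\rangle)\mapsto M\langle\!\langle v_{\mathsf m}\rangle\!\rangle$; (ax$_{m2}$) $\mathsf{cut}(n,m.t)\mapsto \{n/m\}t$; ($\otimes$) $\mathsf{cut}((s,u),m.M\langle\mathsf{par}(m,x.y.t)\rangle)\mapsto M\langle L\langle\mathsf{cut}(v,x.L'\langle\mathsf{cut}(v',y.t)\rangle)\rangle\rangle$ where $s=L\langle v\rangle$, $u=L'\langle v'\rangle$; ($\multimap$) $\mathsf{cut}(\lambda y.s,m.M\langle\mathsf{sub}(m,v,x.t)\rangle)\mapsto M\langle\mathsf{cut}(v,y.L\langle\mathsf{cut}(v',x.t)\rangle)\rangle$ where $s=L\langle v'\rangle$; (ax$_{e1}$) $\mathsf{cut}(v_{\mathsf e},e.C\langle\!\langle e\rangle\!\rangle)\mapsto\mathsf{cut}(v_{\mathsf e},e.C\langle\!\langle v_{\mathsf e}\rangle\!\rangle)$; (ax$_{e2}$) $\mathsf{cut}(f,e.C\langle\mathsf{der}(e,x.t)\rangle)\mapsto\mathsf{cut}(f,e.C\langle\mathsf{der}(f,x.t)\rangle)$; (!der) $\mathsf{cut}(!s,e.C\langle\mathsf{der}(e,x.t)\rangle)\mapsto\mathsf{cut}(!s,e.C\langle L\langle\mathsf{cut}(v,x.t)\rangle\rangle)$ where $s=L\langle v\rangle$; (w) $\mathsf{cut}(v_{\mathsf e},e.t)\mapsto t$ if $e\notin\mathrm{fv}(t)$; (ess) $\mathsf{cut}(v_{\mathsf e},e.t)\mapsto\{v_{\mathsf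 e}/e\}t$. Each root rule $\mapsto_a$ induces $\to_a$ by closure under general contexts. Notations: $\to_{\mathsf m}:=\to_{ax_{m1}}\cup\to_{ax_{m2}}\cup\to_\otimes\cup\to_\multimap$; $\to_{\mathrm{ems}} := \to_{ax_{e1}}\cup\to_{ax_{e2}}\cup\to_{!der}\cup\to_w$; $\to_{\mathrm{ss}}:=\to_{\mathsf m}\cup\to_{\mathrm{ess}}$; $\to_{\mathrm{ms}}:=\to_{\mathsf m}\cup\to_{\mathrm{ems}}$; $\to_{\mathrm{ms}\neg\multimap}:=\to_{ax_{m1}}\cup\to_{ax_{m2}}\cup\to_\otimes\cup\to_{\mathrm{ems}}$; $\to_{\mathrm{ss}\neg\multimap}:=\to_{ax_{m1}}\cup\to_{ax_{m2}}\cup\to_\otimes\cup\to_{\mathrm{ess}}$. *)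

(* Defs.v *)
From HB Require Import structures.
From mathcomp Require Import all_boot.

Set Implicit Arguments.
Unset Strict Implicit.
Unset Printing Implicit Defensive.

(* Raw syntax with named variables.  The terms of the calculus are the classes *)
(* of raw terms under [alpha] below.                                           *)

Definition mvar := nat.
Definition evar := nat.

Inductive var := MV of mvar | EV of evar.

Definition var_code (x : var) : mvar + evar :=
  match x with MV m => inl m | EV e => inr e end.
Definition var_decode (c : mvar + evar) : var :=
  match c with inl m => MV m | inr e => EV e end.
Lemma var_codeK : cancel var_code var_decode. Proof. by case. Qed.
HB.instance Definition _ := Equality.copy var (can_type var_codeK).

Definition same_kind (x y : var) : bool :=
  match x, y with
  | MV _, MV _ | EV _, EV _ => true
  | _, _ => false
  end.

Inductive term :=
  | Val of value
  | Cut of value & var & term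
  | Par of mvar & var & var & term
  | Subt of mvar & value & var & term
  | Der of evar & var & term
with value :=
  | VM of mvalue
  | VE of evalue
with mvalue :=
  | MVar of mvar
  | Pair of term & term
  | Lam of var & term
with evalue :=
  | EVar of evar
  | Bang of term.

Coercion Val : value >-> term.
Coercion VM : mvalue >-> value.
Coercion VE : evalue >-> value.

Definition unbind (x : var) (s : seq var) : seq var := [seq z <- s | z != x].

Fixpoint fv (t : term) : seq var :=
  match t with
  | Val v => fv_val v
  | Cut v x t => fv_val v ++ unbind x (fv t)
  | Par m x y t => MV m :: unbind x (unbind y (fv t))
  | Subt m v x t => MV m :: fv_val v ++ unbind x (fv t)
  | Der e x t => EV e :: unbind x (fv t)
  end
with fv_val (v : value) : seq var :=
  match v with VM w => fv_mval w | VE w => fv_eval w end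
with fv_mval (v : mvalue) : seq var :=
  match v with
  | MVar m => [:: MV m]
  | Pair t s => fv t ++ fv s
  | Lam x t => unbind x (fv t)
  end
with fv_eval (v : evalue) : seq var :=
  match v with
  | EVar e => [:: EV e]
  | Bang t => fv t
  end.

(* All binding occurrences, with multiplicity. *)
Fixpoint bv (t : term) : seq var :=
  match t with
  | Val v => bv_val v
  | Cut v x t => bv_val v ++ x :: bv t
  | Par _ x y t => x :: y :: bv t
  | Subt _ v x t => bv_val v ++ x :: bv t
  | Der _ x t => x :: bv t
  end
with bv_val (v : value) : seq var :=
  match v with VM w => bv_mval w | VE w => bv_eval w end
with bv_mval (v : mvalue) : seq var :=
  match v with
  | MVar _ => [::]
  | Pair t s => bv t ++ bv s
  | Lam x t => x :: bv t
  end
with bv_eval (v : evalue) : seq var :=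
  match v with
  | EVar _ => [::]
  | Bang t => bv t
  end.

Definition fresh_for (xs ys : seq var) : bool := ~~ has (mem ys) xs.

(* [aeq env t u]: t and u are alpha-equivalent when the binders crossed so far *)
(* are matched pairwise as recorded in env, innermost first.                   *)
Fixpoint aeq_var (env : seq (var * var)) (x y : var) : bool :=
  match env with
  | [::] => x == y
  | (a, b) :: env' =>
      if (x == a) || (y == b) then (x == a) && (y == b) else aeq_var env' x y
  end.

Fixpoint aeq (env : seq (var * var)) (t u : term) : bool :=
  match t, u with
  | Val v, Val v' => aeq_val env v v'
  | Cut v x t, Cut v' x' t' =>
      [&& same_kind x x', aeq_val env v v' & aeq ((x, x') :: env) t t']
  | Par m x y t, Par m' x' y' t' =>
      [&& same_kind x x', same_kind y y', aeq_var env (MV m) (MV m')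
        & aeq ((y, y') :: (x, x') :: env) t t']
  | Subt m v x t, Subt m' v' x' t' =>
      [&& same_kind x x', aeq_var env (MV m) (MV m'), aeq_val env v v'
        & aeq ((x, x') :: env) t t']
  | Der e x t, Der e' x' t' =>
      [&& same_kind x x', aeq_var env (EV e) (EV e')
        & aeq ((x, x') :: env) t t']
  | _, _ => false
  end
with aeq_val (env : seq (var * var)) (v w : value) : bool :=
  match v, w with
  | VM v, VM w => aeq_mval env v w
  | VE v, VE w => aeq_eval env v w
  | _, _ => false
  end
with aeq_mval (env : seq (var * var)) (v w : mvalue) : bool :=
  match v, w with
  | MVar m, MVar m' => aeq_var env (MV m) (MV m')
  | Pair t s, Pair t' s' => aeq env t t' && aeq env s s'
  | Lam x t, Lam x' t' => same_kind x x' && aeq ((x, x') :: env) t t'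
  | _, _ => false
  end
with aeq_eval (env : seq (var * var)) (v w : evalue) : bool :=
  match v, w with
  | EVar e, EVar e' => aeq_var env (EV e) (EV e')
  | Bang t, Bang t' => aeq env t t'
  | _, _ => false
  end.

Definition alpha (t u : term) : bool := aeq [::] t u.

(* Barendregt's convention: all binding occurrences carry pairwise distinct    *)
(* names, which are moreover distinct from the free variables.  Every term has *)
(* such an alpha-representative.                                               *)
Definition well_named (t : term) : bool := uniq (bv t) && fresh_for (bv t) (fv t).

Inductive lctx :=
  | LHole
  | LCut of value & var & lctx
  | LPar of mvar & var & var & lctx
  | LSubt of mvar & value & var & lctx
  | LDer of evar & var & lctx.

Fixpoint lplug (L : lctx) (t : term) : term :=
  match L with
  | LHole => t
  | LCut v x L => Cut v x (lplug L t)
  | LPar m x y L => Par m x y (lplug L t)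
  | LSubt m v x L => Subt m v x (lplug L t)
  | LDer e x L => Der e x (lplug L t)
  end.

(* The variables that a left context captures in its hole. *)
Fixpoint lcapt (L : lctx) : seq var :=
  match L with
  | LHole => [::]
  | LCut _ x L => x :: lcapt L
  | LPar _ x y L => x :: y :: lcapt L
  | LSubt _ _ x L => x :: lcapt L
  | LDer _ x L => x :: lcapt L
  end.

(* The unique decomposition t = L<v>. *)
Fixpoint lsplit (t : term) : lctx * value :=
  match t with
  | Val v => (LHole, v)
  | Cut v x t => let: (L, w) := lsplit t in (LCut v x L, w)
  | Par m x y t => let: (L, w) := lsplit t in (LPar m x y L, w)
  | Subt m v x t => let: (L, w) := lsplit t in (LSubt m v x L, w)
  | Der e x t => let: (L, w) := lsplit t in (LDer e x L, w)
  end.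

Lemma lsplitK (t : term) : lplug (lsplit t).1 (lsplit t).2 = t.
Proof.
by elim: t => //= [v x t|m x y t|m v x t|e x t]; case: (lsplit t) => L w /= ->.
Qed.

Inductive ctx :=
  | CVal of vctx
  | CCut of vctx & var & term
  | CSubt of mvar & vctx & var & term
  | CLeft of lctx & ctx
with vctx :=
  | VHole
  | VPairl of ctx & term
  | VPairr of term & ctx
  | VLam of var & ctx
  | VBang of ctx.

(* The multiplicative contexts M are the general contexts built without !.    *)
Fixpoint is_mctx (C : ctx) : bool :=
  match C with
  | CVal V => is_mvctx V
  | CCut V _ _ => is_mvctx V
  | CSubt _ V _ _ => is_mvctx V
  | CLeft _ C => is_mctx C
  end
with is_mvctx (V : vctx) : bool :=
  match V with
  | VHole => true
  | VPairl C _ => is_mctx C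
  | VPairr _ C => is_mctx C
  | VLam _ C => is_mctx C
  | VBang _ => false
  end.

Fixpoint capt (C : ctx) : seq var :=
  match C with
  | CVal V => vcapt V
  | CCut V _ _ => vcapt V
  | CSubt _ V _ _ => vcapt V
  | CLeft L C => lcapt L ++ capt C
  end
with vcapt (V : vctx) : seq var :=
  match V with
  | VHole => [::]
  | VPairl C _ => capt C
  | VPairr _ C => capt C
  | VLam x C => x :: capt C
  | VBang C => capt C
  end.

(* [plug C t u]: u is C<t>, with capture by the binders of C allowed.         *)
(* For cut(V,x.s) and sub(m,V,x.s), V<t> = L<v> and L is extracted; when V is *)
(* not the bare hole, V<t> is a value and L is empty.  The binders of the     *)
(* extracted L must not capture variables of the construct that L is moved    *)
(* over, which makes [plug] partial on raw terms; a suitable representative   *)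
(* of t always exists.                                                        *)
Inductive plug : ctx -> term -> term -> Prop :=
  | plug_val V t u : vplug V t u -> plug (CVal V) t u
  | plug_cut V x s t L (v : value) :
      vplug V t (lplug L v) ->
      fresh_for (lcapt L) (unbind x (fv s)) ->
      plug (CCut V x s) t (lplug L (Cut v x s))
  | plug_subt m V x s t L (v : value) :
      vplug V t (lplug L v) ->
      fresh_for (lcapt L) (MV m :: unbind x (fv s)) ->
      plug (CSubt m V x s) t (lplug L (Subt m v x s))
  | plug_left L C t u : plug C t u -> plug (CLeft L C) t (lplug L u)
with vplug : vctx -> term -> term -> Prop :=
  | vplug_hole t : vplug VHole t t
  | vplug_pairl C s t u : plug C t u -> vplug (VPairl C s) t (Pair u s)
  | vplug_pairr s C t u : plug C t u -> vplug (VPairr s C) t (Pair s u)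
  | vplug_lam x C t u : plug C t u -> vplug (VLam x C) t (Lam x u)
  | vplug_bang C t u : plug C t u -> vplug (VBang C) t (Bang u).

(* C<<t>> *)
Definition plug_nc (C : ctx) (t u : term) : Prop :=
  fresh_for (capt C) (fv t) /\ plug C t u.

(* {n/m}t and {w/e}t below do not rename binders: they are only used inside   *)
(* well-named terms, where no capture can arise.                              *)
Section MRename.
Variables (n m : mvar).

Definition mren_var (o : mvar) : mvar := if o == m then n else o.

Fixpoint mren (t : term) : term :=
  match t with
  | Val v => mren_val v
  | Cut v x t => Cut (mren_val v) x (if x == MV m then t else mren t)
  | Par o x y t =>
      Par (mren_var o) x y
        (if (x == MV m) || (y == MV m) then t else mren t)
  | Subt o v x t =>
      Subt (mren_var o) (mren_val v) x (if x == MV m then t else mren t)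
  | Der e x t => Der e x (if x == MV m then t else mren t)
  end
with mren_val (v : value) : value :=
  match v with VM w => mren_mval w | VE w => mren_eval w end
with mren_mval (v : mvalue) : mvalue :=
  match v with
  | MVar o => MVar (mren_var o)
  | Pair t s => Pair (mren t) (mren s)
  | Lam x t => Lam x (if x == MV m then t else mren t)
  end
with mren_eval (v : evalue) : evalue :=
  match v with
  | EVar f => EVar f
  | Bang t => Bang (mren t)
  end.

End MRename.

Section ESubst.
Variables (w : evalue) (e : evar).

(* {w/e}der(e,x.t), where t' is {w/e}t *)
Definition esubst_der (x : var) (t' : term) : term :=
  match w with
  | EVar f => Der f x t'
  | Bang s => let: (L, v) := lsplit s in lplug L (Cut v x t')
  end.

Fixpoint esubst (t : term) : term :=
  match t with
  | Val v => esubst_val v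
  | Cut v x t => Cut (esubst_val v) x (if x == EV e then t else esubst t)
  | Par o x y t =>
      Par o x y (if (x == EV e) || (y == EV e) then t else esubst t)
  | Subt o v x t => Subt o (esubst_val v) x (if x == EV e then t else esubst t)
  | Der f x t =>
      let t' := if x == EV e then t else esubst t in
      if f == e then esubst_der x t' else Der f x t'
  end
with esubst_val (v : value) : value :=
  match v with VM v => esubst_mval v | VE v => esubst_eval v end
with esubst_mval (v : mvalue) : mvalue :=
  match v with
  | MVar o => MVar o
  | Pair t s => Pair (esubst t) (esubst s)
  | Lam x t => Lam x (if x == EV e then t else esubst t)
  end
with esubst_eval (v : evalue) : evalue :=
  match v with
  | EVar f => if f == e then w else EVar f
  | Bang t => Bang (esubst t)
  end.

End ESubst.

Inductive root_axm1 : term -> term -> Prop :=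
  | Root_axm1 (v : mvalue) m M t u :
      is_mctx M -> plug_nc M (MVar m) t -> plug_nc M v u ->
      root_axm1 (Cut v (MV m) t) u.

Inductive root_axm2 : term -> term -> Prop :=
  | Root_axm2 n m t : root_axm2 (Cut (MVar n) (MV m) t) (mren n m t).

Inductive root_tensor : term -> term -> Prop :=
  | Root_tensor L (v : value) L' (v' : value) m M x y t r r' :
      is_mctx M -> MV m \notin capt M ->
      plug M (Par m x y t) r ->
      plug M (lplug L (Cut v x (lplug L' (Cut v' y t)))) r' ->
      root_tensor (Cut (Pair (lplug L v) (lplug L' v')) (MV m) r) r'.

Inductive root_lolli : term -> term -> Prop :=
  | Root_lolli y L (v' : value) m M (v : value) x t r r' :
      is_mctx M -> MV m \notin capt M ->
      plug M (Subt m v x t) r ->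
      plug M (Cut v y (lplug L (Cut v' x t))) r' ->
      root_lolli (Cut (Lam y (lplug L v')) (MV m) r) r'.

Inductive root_axe1 : term -> term -> Prop :=
  | Root_axe1 (v : evalue) e C t u :
      plug_nc C (EVar e) t -> plug_nc C v u ->
      root_axe1 (Cut v (EV e) t) (Cut v (EV e) u).

Inductive root_axe2 : term -> term -> Prop :=
  | Root_axe2 f e C x t r r' :
      EV e \notin capt C ->
      plug C (Der e x t) r -> plug C (Der f x t) r' ->
      root_axe2 (Cut (EVar f) (EV e) r) (Cut (EVar f) (EV e) r').

Inductive root_bder : term -> term -> Prop :=
  | Root_bder L (v : value) e C x t r r' :
      EV e \notin capt C ->
      plug C (Der e x t) r -> plug C (lplug L (Cut v x t)) r' ->
      root_bder (Cut (Bang (lplug L v)) (EV e) r)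
                (Cut (Bang (lplug L v)) (EV e) r').

Inductive root_w : term -> term -> Prop :=
  | Root_w (v : evalue) e t : EV e \notin fv t -> root_w (Cut v (EV e) t) t.

Inductive root_ess : term -> term -> Prop :=
  | Root_ess (v : evalue) e t : root_ess (Cut v (EV e) t) (esubst v e t).

(* Closure of a root rule under general contexts, on alpha-classes: the rule  *)
(* is applied to a well-named representative of the whole term.  Hence no     *)
(* context moved or crossed by the rule captures anything unintended, and, in *)
(* the non-linear case of ax_m1, tensor and lolli, the occurrences of the cut *)
(* variable other than the one acted upon become globally free instead of     *)
(* being caught by an unrelated outer binder.                                 *)
Definition closure (root : term -> term -> Prop) (t u : term) : Prop :=
  exists t0 u0 C r r',
    [/\ alpha t t0, well_named t0, plug C r t0, root r r' & plug C r' u0]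
    /\ alpha u0 u.

Definition runion (R S : term -> term -> Prop) (t u : term) : Prop :=
  R t u \/ S t u.
Infix "\+r" := runion (at level 50, left associativity).

Definition to_axm1 := closure root_axm1.
Definition to_axm2 := closure root_axm2.
Definition to_tensor := closure root_tensor.
Definition to_lolli := closure root_lolli.
Definition to_axe1 := closure root_axe1.
Definition to_axe2 := closure root_axe2.
Definition to_bder := closure root_bder.
Definition to_w := closure root_w.
Definition to_ess := closure root_ess.

Definition to_m := to_axm1 \+r to_axm2 \+r to_tensor \+r to_lolli.
Definition to_ems := to_axe1 \+r to_axe2 \+r to_bder \+r to_w.
Definition to_ms_nololli := to_axm1 \+r to_axm2 \+r to_tensor \+r to_ems.
Definition to_ss_nololli := to_axm1 \+r to_axm2 \+r to_tensor \+r to_ess.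

Definition strongly_normalizing (R : term -> term -> Prop) (t : term) : Prop :=
  ~ exists f : nat -> term, f 0 = t /\ forall i, R (f i) (f i.+1).

(* Main.v *)
(** Every multiplicative step decreases the number of constructors.  For the
    fragments without the lolli rule, no abstraction is ever opened, so a term
    can be evaluated by plain structural recursion in an environment that gives
    a finite tree of costs to each variable: a bang carries the cost of its
    body, a pair has two subtrees, an abstraction is opaque and a free variable
    costs nothing.  The cost of a term charges each use of an exponential
    variable with the cost of the value it is bound to; this bounds the effect
    of all copies in advance, hence ess, each micro-step, and the steps axm1,
    axm2 and tensor all strictly decrease it.  The multiplicative steps move a
    cost into a context that does not cross a bang, where it is counted exactly
    once, which is what makes the balance of costs work. *)

Require Import Defs.
From mathcomp Require Import all_boot.
From mathcomp Require Import zify.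

Set Implicit Arguments.
Unset Strict Implicit.
Unset Printing Implicit Defensive.

(* Mutual induction principles and the constructor count *)
Scheme term_mut := Induction for term Sort Prop
  with value_mut := Induction for value Sort Prop
  with mvalue_mut := Induction for mvalue Sort Prop
  with evalue_mut := Induction for evalue Sort Prop.
Combined Scheme term_value_ind from term_mut, value_mut, mvalue_mut, evalue_mut.

Scheme ctx_mut := Induction for ctx Sort Prop
  with vctx_mut := Induction for vctx Sort Prop.
Combined Scheme ctx_vctx_ind from ctx_mut, vctx_mut.

Scheme plug_mut := Minimality for plug Sort Prop
  with vplug_mut := Minimality for vplug Sort Prop.
Combined Scheme plug_vplug_ind from plug_mut, vplug_mut.

Fixpoint tsize (t : term) : nat :=
  match t with
  | Val v => vsize v
  | Cut v _ t => (vsize v + tsize t).+1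
  | Par _ _ _ t => (tsize t).+1
  | Subt _ v _ t => (vsize v + tsize t).+1
  | Der _ _ t => (tsize t).+1
  end
with vsize (v : value) : nat :=
  match v with VM w => mvsize w | VE w => evsize w end
with mvsize (v : mvalue) : nat :=
  match v with
  | MVar _ => 1
  | Pair t s => (tsize t + tsize s).+1
  | Lam _ t => (tsize t).+1
  end
with evsize (v : evalue) : nat :=
  match v with
  | EVar _ => 1
  | Bang t => (tsize t).+1
  end.

(** A context adds a fixed number of constructors; comparing two fillings additively avoids
    truncated subtraction on [nat]. *)
Lemma tsize_lplug L t t' :
  tsize (lplug L t) + tsize t' = tsize (lplug L t') + tsize t.
Proof. elim: L => /= *; lia. Qed.

(** When the hole is the value of a cut or a subtraction, the two fillings may extract different
    left contexts, but extraction moves constructors without changing their number. *)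
Lemma tsize_plug t t' :
  (forall C u u', plug C t u -> plug C t' u' ->
     tsize u + tsize t' = tsize u' + tsize t) /\
  (forall V u u', vplug V t u -> vplug V t' u' ->
     tsize u + tsize t' = tsize u' + tsize t).
Proof.
apply: ctx_vctx_ind => [V IH|V IH x s|m V IH x s|L C IH||C IH s|s C IH|x C IH|C IH]
  u u' H H'; inversion H; inversion H'; subst => //=;
  try (have := IH _ _ ltac:(eassumption) ltac:(eassumption)) => //; try lia.
- have /= := tsize_lplug L v (Cut v x s).
  have /= := tsize_lplug L0 v0 (Cut v0 x s); lia.
- have /= := tsize_lplug L v (Subt m v x s).
  have /= := tsize_lplug L0 v0 (Subt m v0 x s); lia.
- have := tsize_lplug L u0 u1; lia.
Qed.

Lemma tsize_aeq :
  (forall t env u, aeq env t u -> tsize t = tsize u) /\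
  (forall v env w, aeq_val env v w -> vsize v = vsize w) /\
  (forall v env w, aeq_mval env v w -> mvsize v = mvsize w) /\
  (forall v env w, aeq_eval env v w -> evsize v = evsize w).
Proof.
apply: term_value_ind => [v IHv|v IHv x t IHt|m x y t IHt|m v IHv x t IHt
  |e x t IHt|v IHv|v IHv|m|t IHt s IHs|x t IHt|e|t IHt] env [] //=.
- by move=> w /IHv.
- by move=> w y u /and3P[_ /IHv-> /IHt->].
- by move=> m' x' y' u /and4P[_ _ _ /IHt->].
- by move=> m' w x' u /and4P[_ _ /IHv-> /IHt->].
- by move=> e' x' u /and3P[_ _ /IHt->].
- by move=> w /IHv.
- by move=> w /IHv.
- by move=> t' s' /andP[/IHt-> /IHs->].
- by move=> x' u /andP[_ /IHt->].
- by move=> u /IHt->.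
Qed.

Lemma tsize_mren n m :
  (forall t, tsize (mren n m t) = tsize t) /\
  (forall v, vsize (mren_val n m v) = vsize v) /\
  (forall v, mvsize (mren_mval n m v) = mvsize v) /\
  (forall v, evsize (mren_eval n m v) = evsize v).
Proof.
apply: term_value_ind => //=; intros; repeat case: ifP => _; lia.
Qed.

(** * From decreasing measures to strong normalization *)

Lemma closure_measure (mu : term -> nat) (root : term -> term -> Prop) :
  (forall t u, alpha t u -> mu t = mu u) ->
  (forall C r r' t u, well_named t -> root r r' -> plug C r t -> plug C r' u ->
     mu u < mu t) ->
  forall t u, Defs.closure root t u -> mu u < mu t.
Proof.
move=> mu_alpha mu_root t u [t0 [u0 [C [r [r']]]]].
case=> -[/mu_alpha-> wn_t0 Ct0 rr' Cu0] /mu_alpha<-.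
exact: mu_root wn_t0 rr' Ct0 Cu0.
Qed.

Lemma measure_sn (mu : term -> nat) (R : term -> term -> Prop) :
  (forall t u, R t u -> mu u < mu t) -> forall t, strongly_normalizing R t.
Proof.
move=> mu_R t [f [_ fR]].
have le_f i : mu (f i) + i <= mu (f 0).
  by elim: i => [|i IHi]; [rewrite addn0 | have := mu_R _ _ (fR i); lia].
have := le_f (mu (f 0)).+1; lia.
Qed.

Lemma closure_tsize (root : term -> term -> Prop) :
  (forall r r', root r r' -> tsize r' < tsize r) ->
  forall t u, Defs.closure root t u -> tsize u < tsize t.
Proof.
move=> dec; apply: closure_measure => [t u|C r r' t u _ /dec lt_r Ct Cu].
  exact: tsize_aeq.1.
have := (tsize_plug r r').1 _ _ _ Ct Cu; lia.
Qed.

(** Multiplicative rules copy nothing. The two axioms lose a cut and a variable; tensor trades a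
    cut, a pair and a par for two cuts; lolli trades a cut, an abstraction and a subtraction for two
    cuts. *)
Lemma to_m_tsize t u : to_m t u -> tsize u < tsize t.
Proof.
case=> [[[]|]|]; apply: closure_tsize => _ _ [].
- move=> v m M r r' _ [_ Mr] [_ Mr'].
  have /= := (tsize_plug _ _).1 _ _ _ Mr Mr'; lia.
- by move=> n m r /=; rewrite (tsize_mren n m).1; lia.
- move=> L v L' v' m M x y s r r' _ _ Mr Mr'.
  have /= := (tsize_plug _ _).1 _ _ _ Mr Mr'.
  have /= := tsize_lplug L v (Cut v x (lplug L' (Cut v' y s))).
  have /= := tsize_lplug L' v' (Cut v' y s); lia.
- move=> y L v' m M v x s r r' _ _ Mr Mr'.
  have /= := (tsize_plug _ _).1 _ _ _ Mr Mr'.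
  have /= := tsize_lplug L v' (Cut v' x s); lia.
Qed.

(** * Cost trees and the evaluation of terms *)

(* A binary tree of costs, given by the label at the end of each path: the root *)
(* label is the cost of an exponential value, [true] leads to the body of a     *)
(* bang or the first component of a pair, [false] to the second component.      *)
Definition den := seq bool -> nat.
Definition den0 : den := fun _ => 0.
Definition dnode (k : nat) (d1 d2 : den) : den :=
  fun p => if p is b :: q then (if b then d1 q else d2 q) else k.
Definition dproj (b : bool) (d : den) : den := fun q => d (b :: q).
Definition dle (d d' : den) : Prop := forall p, d p <= d' p.

Definition env := var -> den.
Definition env0 : env := fun _ => den0.
Definition upd (r : env) (x : var) (d : den) : env :=
  fun z => if z == x then d else r z.

(* The cost of a term and its denotation. *)
Fixpoint ev (t : term) (r : env) : nat * den :=
  match t with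
  | Val v => ev_val v r
  | Cut v x t =>
      let a := ev_val v r in
      let b := ev t (upd r x a.2) in ((a.1 + b.1).+1, b.2)
  | Par m x y t =>
      let d := r (MV m) in
      let b := ev t (upd (upd r x (dproj true d)) y (dproj false d)) in
      (b.1.+1, b.2)
  | Subt m v x t =>
      let b := ev t (upd r x den0) in (((ev_val v r).1 + b.1).+1, b.2)
  | Der e x t =>
      let d := r (EV e) in
      let b := ev t (upd r x (dproj true d)) in ((d [::] + b.1).+1, b.2)
  end
with ev_val (v : value) (r : env) : nat * den :=
  match v with VM w => ev_mval w r | VE w => ev_eval w r end
with ev_mval (v : mvalue) (r : env) : nat * den :=
  match v with
  | MVar m => (1, r (MV m))
  | Pair t s =>
      let a := ev t r in
      let b := ev s r in ((a.1 + b.1).+1, dnode 0 a.2 b.2)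
  | Lam x t => ((ev t (upd r x den0)).1.+1, den0)
  end
with ev_eval (v : evalue) (r : env) : nat * den :=
  match v with
  | EVar e =>
      let d := r (EV e) in
      ((d [::]).+1, dnode (d [::]).+1 (dproj true d) (dproj false d))
  | Bang t => let a := ev t r in (a.1.+1, dnode a.1.+1 a.2 den0)
  end.

(* The offsets account for a cost that a step moves from outside a context into *)
(* its hole. *)
Definition rle (a b : nat) (p p' : nat * den) : Prop :=
  p.1 + a <= p'.1 + b /\ dle p.2 p'.2.

(** * Monotonicity and alpha-invariance of evaluation *)

Lemma dle_refl d : dle d d. Proof. by []. Qed.

Lemma dle_dproj b d d' : dle d d' -> dle (dproj b d) (dproj b d').
Proof. by move=> le_d p; apply: le_d. Qed.

Lemma dle_dnode k k' d1 d1' d2 d2' :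
  k <= k' -> dle d1 d1' -> dle d2 d2' -> dle (dnode k d1 d2) (dnode k' d1' d2').
Proof. by move=> ? ? ? [|[] p] /=. Qed.

Lemma dle_upd r r' x d d' z :
  dle d d' -> (z != x -> dle (r z) (r' z)) -> dle (upd r x d z) (upd r' x d' z).
Proof. by rewrite /upd; case: eqP => // _ _; apply. Qed.

Lemma mem_unbind x s z : (z \in unbind x s) = (z != x) && (z \in s).
Proof. by rewrite mem_filter. Qed.

(** Costs are only added up, and trees only projected and grafted. Comparing just the free variables
    lets the environments differ on binders that a step moves or erases. *)
Lemma ev_mono :
  (forall t r r', (forall z, z \in fv t -> dle (r z) (r' z)) ->
     rle 0 0 (ev t r) (ev t r')) /\
  (forall v r r', (forall z, z \in fv_val v -> dle (r z) (r' z)) ->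
     rle 0 0 (ev_val v r) (ev_val v r')) /\
  (forall v r r', (forall z, z \in fv_mval v -> dle (r z) (r' z)) ->
     rle 0 0 (ev_mval v r) (ev_mval v r')) /\
  (forall v r r', (forall z, z \in fv_eval v -> dle (r z) (r' z)) ->
     rle 0 0 (ev_eval v r) (ev_eval v r')).
Proof.
apply: term_value_ind => [v IHv|v IHv x t IHt|m x y t IHt|m v IHv x t IHt
  |e x t IHt|v IHv|v IHv|m|t IHt s IHs|x t IHt|e|t IHt] r r' le_r //=.
- exact: IHv.
- have [le1 le2] : rle 0 0 (ev_val v r) (ev_val v r').
    by apply: IHv => z vz; apply: le_r; rewrite mem_cat vz.
  have [/= le3 le4] : rle 0 0 (ev t (upd r x (ev_val v r).2))
                         (ev t (upd r' x (ev_val v r').2)).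
    apply: IHt => z tz; apply: dle_upd => // zx; apply: le_r.
    by rewrite mem_cat mem_unbind zx tz orbT.
  by split=> //=; lia.
- have le_m b : dle (dproj b (r (MV m))) (dproj b (r' (MV m))).
    by apply/dle_dproj/le_r; rewrite inE eqxx.
  have [|/= le1 le2] := IHt
    (upd (upd r x (dproj true (r (MV m)))) y (dproj false (r (MV m))))
    (upd (upd r' x (dproj true (r' (MV m)))) y (dproj false (r' (MV m)))).
    move=> z tz; do 2![apply: dle_upd => // ?]; apply: le_r.
    by rewrite inE !mem_unbind tz; apply/orP; right; apply/and3P.
  by split=> //=; lia.
- have [le1 _] : rle 0 0 (ev_val v r) (ev_val v r').
    by apply: IHv => z vz; apply: le_r; rewrite inE mem_cat vz orbT.
  have [/= le3 le4] : rle 0 0 (ev t (upd r x den0)) (ev t (upd r' x den0)).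
    apply: IHt => z tz; apply: dle_upd => // zx; apply: le_r.
    by rewrite inE mem_cat mem_unbind zx tz !orbT.
  by split=> //=; lia.
- have le_e : dle (r (EV e)) (r' (EV e)) by apply: le_r; rewrite inE eqxx.
  have [/= le3 le4] : rle 0 0 (ev t (upd r x (dproj true (r (EV e)))))
                         (ev t (upd r' x (dproj true (r' (EV e))))).
    apply: IHt => z tz; apply: dle_upd => [|zx]; first exact: dle_dproj.
    by apply: le_r; rewrite inE mem_unbind zx tz orbT.
  by split=> //=; have := le_e [::]; lia.
- exact: IHv.
- exact: IHv.
- by split=> //=; apply: le_r; rewrite inE.
- have [|/= le1 le2] := IHt r r'.
    by move=> z tz; apply: le_r; rewrite mem_cat tz.
  have [|/= le3 le4] := IHs r r'.
    by move=> z tz; apply: le_r; rewrite mem_cat tz orbT.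
  by split=> /=; [lia | apply: dle_dnode].
- have [|/= le1 _] := IHt (upd r x den0) (upd r' x den0).
    by move=> z tz; apply: dle_upd => // zx; apply: le_r; rewrite mem_unbind zx.
  by split=> //=; lia.
- have le_e : dle (r (EV e)) (r' (EV e)) by apply: le_r; rewrite inE.
  split=> /=; first by have := le_e [::]; lia.
  by apply: dle_dnode; [exact: le_e | exact: dle_dproj..].
- have [/= le1 le2] := IHt r r' le_r.
  by split=> /=; [lia | apply: dle_dnode => //; lia].
Qed.

(** The invariant behind the exponential steps. An occurrence of a variable costs one more than the
    root label it reads, and a dereliction pays that label on top of its own constructor and body;
    so each copy is prepaid, with one unit left over. *)
Lemma ev_eval_cost w r : (ev_eval w r).2 [::] = (ev_eval w r).1.
Proof. by case: w. Qed.

(** Binders matched in [E] are updated with the same denotation, so the environments stay equal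
    along matched variables. *)
Lemma ev_aeq :
  (forall t E u r s, aeq E t u ->
     (forall x y, aeq_var E x y -> r x = s y) -> ev t r = ev u s) /\
  (forall v E w r s, aeq_val E v w ->
     (forall x y, aeq_var E x y -> r x = s y) -> ev_val v r = ev_val w s) /\
  (forall v E w r s, aeq_mval E v w ->
     (forall x y, aeq_var E x y -> r x = s y) -> ev_mval v r = ev_mval w s) /\
  (forall v E w r s, aeq_eval E v w ->
     (forall x y, aeq_var E x y -> r x = s y) -> ev_eval v r = ev_eval w s).
Proof.
have updE (E : seq (var * var)) r s a b (d : den) :
  (forall x y, aeq_var E x y -> r x = s y) ->
  forall x y, aeq_var ((a, b) :: E) x y -> upd r a d x = upd s b d y.
  move=> rs x y /=; rewrite /upd; case: eqP => //= _; first by move->.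
  by case: eqP => //= _; apply: rs.
apply: term_value_ind => [v IHv|v IHv x t IHt|m x y t IHt|m v IHv x t IHt
  |e x t IHt|v IHv|v IHv|m|t IHt s IHs|x t IHt|e|t IHt] E [] //=.
- by move=> w r s' /IHv; apply.
- move=> w y u r s' /and3P[_ /IHv Ev /IHt Et] rs.
  by rewrite (Ev r s') // (Et _ _ (updE _ _ _ _ _ _ rs)).
- move=> m' x' y' u r s' /and4P[_ _ /[swap] /IHt Et] Em rs.
  by rewrite (rs _ _ Em) (Et _ _ (updE _ _ _ _ _ _ (updE _ _ _ _ _ _ rs))).
- move=> m' w x' u r s' /and4P[_ _ /IHv Ev /IHt Et] rs.
  by rewrite (Ev r s') // (Et _ _ (updE _ _ _ _ _ _ rs)).
- move=> e' x' u r s' /and3P[_ Ee /IHt Et] rs.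
  by rewrite (rs _ _ Ee) (Et _ _ (updE _ _ _ _ _ _ rs)).
- by move=> w r s' /IHv; apply.
- by move=> w r s' /IHv; apply.
- by move=> m' r s' Em rs; rewrite (rs _ _ Em).
- by move=> t' s' r r' /andP[/IHt Et /IHs Es] rs; rewrite (Et r r') // (Es r r').
- by move=> x' u r s' /andP[_ /IHt Et] rs; rewrite (Et _ _ (updE _ _ _ _ _ _ rs)).
- by move=> e' r s' Ee rs; rewrite (rs _ _ Ee).
- by move=> u r s' /IHt Et rs; rewrite (Et _ _ rs).
Qed.

(** * Evaluation through left contexts and general contexts *)

Fixpoint lenv (L : lctx) (r : env) : env :=
  match L with
  | LHole => r
  | LCut v x L => lenv L (upd r x (ev_val v r).2)
  | LPar m x y L =>
      lenv L (upd (upd r x (dproj true (r (MV m)))) y (dproj false (r (MV m))))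
  | LSubt _ _ x L => lenv L (upd r x den0)
  | LDer e x L => lenv L (upd r x (dproj true (r (EV e))))
  end.

Fixpoint lcost (L : lctx) (r : env) : nat :=
  match L with
  | LHole => 0
  | LCut v x L => ((ev_val v r).1 + lcost L (upd r x (ev_val v r).2)).+1
  | LPar m x y L =>
      (lcost L (upd (upd r x (dproj true (r (MV m)))) y
                    (dproj false (r (MV m))))).+1
  | LSubt _ v x L => ((ev_val v r).1 + lcost L (upd r x den0)).+1
  | LDer e x L =>
      (r (EV e) [::] + lcost L (upd r x (dproj true (r (EV e))))).+1
  end.

(** Each constructor of a left context adds its own cost and passes on the denotation of its body,
    so extracting a left context shows only in the environment of what it is moved over. *)
Lemma ev_lplug L t r :
  ev (lplug L t) r = (lcost L r + (ev t (lenv L r)).1, (ev t (lenv L r)).2).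
Proof.
by elim: L r => [|v x L IH|m x y L IH|m v x L IH|e x L IH] r /=;
  rewrite ?IH /= ?addSn ?addnA // -surjective_pairing.
Qed.

Lemma lenv_notin L r z : z \notin lcapt L -> lenv L r z = r z.
Proof.
elim: L r => [|v x L IH|m x y L IH|m v x L IH|e x L IH] r //=;
  rewrite !inE !negb_or => /andP[/negPf zx].
- by move/IH->; rewrite /upd zx.
- by case/andP=> /negPf zy /IH->; rewrite /upd zx zy.
- by move/IH->; rewrite /upd zx.
- by move/IH->; rewrite /upd zx.
Qed.

(** Describes the environments met at the hole of a context entered with [R'] and [R]: the binders
    crossed on the way change only variables outside [X], so what a root rule knows about the
    variables of [X] remains valid at the hole. *)
Definition env_rel (X : pred var) (R' R r' r : env) : Prop :=
  (forall z, dle (r' z) (r z)) /\ (forall z, X z -> r' z = R' z /\ r z = R z).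

Lemma env_rel_refl X R' R :
  (forall z, dle (R' z) (R z)) -> env_rel X R' R R' R.
Proof. by []. Qed.

Lemma env_rel_upd X R' R r' r x d' d :
  ~~ X x -> dle d' d -> env_rel X R' R r' r ->
  env_rel X R' R (upd r' x d') (upd r x d).
Proof.
move=> Xx le_d [le_r eq_r]; split=> z; first exact: dle_upd.
by rewrite /upd; case: eqP => [->|_ /eq_r//]; rewrite (negPf Xx).
Qed.

Lemma ev_lplug_mono X R' R a b L t' t :
  {in lcapt L, forall z, ~~ X z} ->
  (forall r' r, env_rel X R' R r' r -> rle a b (ev t' r') (ev t r)) ->
  forall r' r, env_rel X R' R r' r ->
    rle a b (ev (lplug L t') r') (ev (lplug L t) r).
Proof.
elim: L => [|v x L IH|m x y L IH|m v x L IH|e x L IH] //= XL le_t r' r rr.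
- have [/= le1 le2] : rle 0 0 (ev_val v r') (ev_val v r).
    by apply: ev_mono.2.1 => z _; apply: rr.1.
  have [z zL||/= le3 le4] := IH _ le_t (upd r' x (ev_val v r').2) (upd r x (ev_val v r).2).
  + by apply: XL; rewrite inE zL orbT.
  + by apply: env_rel_upd => //; apply: XL; rewrite inE eqxx.
  + by split=> //=; lia.
- have le_m c : dle (dproj c (r' (MV m))) (dproj c (r (MV m))).
    exact/dle_dproj/rr.1.
  have [z zL||/= le3 le4] := IH _ le_t
    (upd (upd r' x (dproj true (r' (MV m)))) y (dproj false (r' (MV m))))
    (upd (upd r x (dproj true (r (MV m)))) y (dproj false (r (MV m)))).
  + by apply: XL; rewrite !inE zL !orbT.
  + apply: env_rel_upd => //; first by apply: XL; rewrite !inE eqxx orbT.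
    by apply: env_rel_upd => //; apply: XL; rewrite inE eqxx.
  + by split=> //=; lia.
- have [/= le1 le2] : rle 0 0 (ev_val v r') (ev_val v r).
    by apply: ev_mono.2.1 => z _; apply: rr.1.
  have [z zL||/= le3 le4] := IH _ le_t (upd r' x den0) (upd r x den0).
  + by apply: XL; rewrite inE zL orbT.
  + by apply: env_rel_upd => //; apply: XL; rewrite inE eqxx.
  + by split=> //=; lia.
- have le_e := rr.1 (EV e).
  have [z zL||/= le3 le4] := IH _ le_t (upd r' x (dproj true (r' (EV e))))
                                   (upd r x (dproj true (r (EV e)))).
  + by apply: XL; rewrite inE zL orbT.
  + apply: env_rel_upd => //; last exact: dle_dproj.
    by apply: XL; rewrite inE eqxx.
  + by split=> //=; have := le_e [::]; lia.
Qed.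

Lemma fresh_forP xs ys : reflect {in xs, forall z, z \notin ys} (fresh_for xs ys).
Proof. exact: (iffP hasPn). Qed.

(* [b <= a] is needed under a bang, whose cost may be counted several times. *)
Lemma ev_plug_mono X R' R a b t' t :
  (forall r' r, env_rel X R' R r' r -> rle a b (ev t' r') (ev t r)) ->
  (forall C u' u, is_mctx C || (b <= a) -> {in capt C, forall z, ~~ X z} ->
     plug C t' u' -> plug C t u ->
     forall r' r, env_rel X R' R r' r -> rle a b (ev u' r') (ev u r)) /\
  (forall V u' u, is_mvctx V || (b <= a) -> {in vcapt V, forall z, ~~ X z} ->
     vplug V t' u' -> vplug V t u ->
     forall r' r, env_rel X R' R r' r -> rle a b (ev u' r') (ev u r)).
Proof.
move=> le_t.
apply: ctx_vctx_ind => [V IH|V IH x s|m V IH x s|L C IH||C IH s|s C IH|x C IH|C IH]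
  u' u MC XC /= H' H; inversion H'; inversion H; subst.
- exact: (IH _ _ MC).
- move=> r' r rr.
  have [] := IH _ _ MC XC ltac:(eassumption) ltac:(eassumption) r' r rr.
  rewrite !ev_lplug /= => le1 le2.
  (* The two fillings may extract different left contexts; by freshness, [s] reads the outer
     environments in both, except at [x]. *)
  match goal with
  | |- rle _ _ (_, (ev s ?f').2) (_, (ev s ?f).2) =>
      have [] : rle 0 0 (ev s f') (ev s f)
  end.
    apply: ev_mono.1 => z sz; apply: dle_upd => // zx.
    have zs : z \in unbind x (fv s) by rewrite mem_unbind zx.
    have out K : fresh_for (lcapt K) (unbind x (fv s)) -> z \notin lcapt K.
      by move/fresh_forP=> fr; apply: contraL zs; apply: fr.
    by rewrite !lenv_notin ?out //; apply: rr.1.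
  by move=> /= le3 le4; split=> //=; lia.
- move=> r' r rr.
  have [] := IH _ _ MC XC ltac:(eassumption) ltac:(eassumption) r' r rr.
  rewrite !ev_lplug /= => le1 le2.
  match goal with
  | |- rle _ _ (_, (ev s ?f').2) (_, (ev s ?f).2) =>
      have [] : rle 0 0 (ev s f') (ev s f)
  end.
    apply: ev_mono.1 => z sz; apply: dle_upd => // zx.
    have zs : z \in MV m :: unbind x (fv s) by rewrite inE mem_unbind zx sz orbT.
    have out K : fresh_for (lcapt K) (MV m :: unbind x (fv s)) -> z \notin lcapt K.
      by move/fresh_forP=> fr; apply: contraL zs; apply: fr.
    by rewrite !lenv_notin ?out //; apply: rr.1.
  by move=> /= le3 le4; split=> //=; lia.
- apply: ev_lplug_mono => [z zL|].
    by apply: XC; rewrite /= mem_cat zL.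
  apply: (IH _ _ MC) => // z zC.
  by apply: XC; rewrite /= mem_cat zC orbT.
- exact: le_t.
- move=> r' r rr.
  have [] := IH _ _ MC XC ltac:(eassumption) ltac:(eassumption) r' r rr.
  move=> le1 le2; have [le3 le4] : rle 0 0 (ev s r') (ev s r).
    by apply: ev_mono.1 => z _; apply: rr.1.
  by split=> /=; [lia | apply: dle_dnode].
- move=> r' r rr.
  have [] := IH _ _ MC XC ltac:(eassumption) ltac:(eassumption) r' r rr.
  move=> le1 le2; have [le3 le4] : rle 0 0 (ev s r') (ev s r).
    by apply: ev_mono.1 => z _; apply: rr.1.
  by split=> /=; [lia | apply: dle_dnode].
- move=> r' r rr.
  have XC' : {in capt C, forall z, ~~ X z}.
    by move=> z zC; apply: XC; rewrite /= inE zC orbT.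
  have [|le1 _] := IH _ _ MC XC' ltac:(eassumption) ltac:(eassumption)
                       (upd r' x den0) (upd r x den0).
    by apply: env_rel_upd => //; apply: XC; rewrite /= inE eqxx.
  by split=> //=; lia.
- move=> r' r rr; move: (MC) => /= ba.
  have MC' : is_mctx C || (b <= a) by rewrite ba orbT.
  have [le1 le2] := IH _ _ MC' XC ltac:(eassumption) ltac:(eassumption) r' r rr.
  by split=> /=; [lia | apply: dle_dnode => //; lia].
Qed.

(** * Bound and free variables of plugged terms *)

Lemma bv_lplug L :
  exists2 s, {subset lcapt L <= s} & forall t, bv (lplug L t) = s ++ bv t.
Proof.
elim: L => [|v x L [s Ls bvE]|m x y L [s Ls bvE]|m v x L [s Ls bvE]|e x L [s Ls bvE]].
- by exists [::].
- exists (bv_val v ++ x :: s) => [z|t] /=; last by rewrite bvE -catA.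
  by rewrite mem_cat !inE => /orP[->|/Ls->]; rewrite !orbT.
- exists (x :: y :: s) => [z|t] /=; last by rewrite bvE.
  by rewrite !inE => /or3P[->|->|/Ls->]; rewrite ?orbT.
- exists (bv_val v ++ x :: s) => [z|t] /=; last by rewrite bvE -catA.
  by rewrite mem_cat !inE => /orP[->|/Ls->]; rewrite !orbT.
- exists (x :: s) => [z|t] /=; last by rewrite bvE.
  by rewrite !inE => /orP[->|/Ls->]; rewrite ?orbT.
Qed.

(** The binders of the context lie on both sides of those of [t], so they are gathered into one list
    [s] only up to permutation. *)
Lemma plug_bv :
  (forall C t u, plug C t u ->
     exists2 s, {subset capt C <= s} & perm_eq (bv u) (s ++ bv t)) /\
  (forall V t u, vplug V t u ->
     exists2 s, {subset vcapt V <= s} & perm_eq (bv u) (s ++ bv t)).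
Proof.
apply: plug_vplug_ind => /=.
- by [].
- move=> V x s t L v _ [s' Vs' eq_s'] _.
  exists (s' ++ x :: bv s) => [z /Vs'|].
    by rewrite mem_cat => ->.
  have [l _ bvE] := bv_lplug L; move: eq_s'; rewrite !bvE /= => eq_s'.
  rewrite catA (permPl (perm_cat eq_s' (perm_refl _))) -!catA perm_cat2l.
  exact: permEl (perm_catC _ _).
- move=> m V x s t L v _ [s' Vs' eq_s'] _.
  exists (s' ++ x :: bv s) => [z /Vs'|].
    by rewrite mem_cat => ->.
  have [l _ bvE] := bv_lplug L; move: eq_s'; rewrite !bvE /= => eq_s'.
  rewrite catA (permPl (perm_cat eq_s' (perm_refl _))) -!catA perm_cat2l.
  exact: permEl (perm_catC _ _).
- move=> L C t u _ [s Cs eq_s]; have [l Ll bvE] := bv_lplug L.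
  exists (l ++ s) => [z|].
    by rewrite !mem_cat => /orP[/Ll|/Cs] ->; rewrite ?orbT.
  by rewrite bvE -catA perm_cat2l.
- by move=> t; exists [::].
- move=> C s t u _ [s' Cs eq_s]; exists (s' ++ bv s) => [z /Cs|].
    by rewrite mem_cat => ->.
  rewrite (permPl (perm_cat eq_s (perm_refl _))) -!catA perm_cat2l.
  exact: permEl (perm_catC _ _).
- move=> s C t u _ [s' Cs eq_s]; exists (bv s ++ s') => [z /Cs|].
    by rewrite mem_cat => ->; rewrite orbT.
  by rewrite -catA perm_cat2l.
- move=> x C t u _ [s' Cs eq_s]; exists (x :: s') => [z|].
    by rewrite !inE => /orP[->|/Cs->]; rewrite ?orbT.
  by rewrite /= perm_cons.
- by [].
Qed.

Lemma fv_lplug_sub L t t' :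
  {subset fv t <= fv t'} -> {subset fv (lplug L t) <= fv (lplug L t')}.
Proof.
move=> tt'; elim: L => [|v x L IH|m x y L IH|m v x L IH|e x L IH] //= z;
  rewrite ?inE ?mem_cat ?inE !mem_unbind; have := IH z;
  case: (z \in fv (lplug L t)) => [->//|_]; rewrite !andbF !orbF;
  first [by move=> -> | by case/orP=> ->; rewrite ?orbT].
Qed.

Lemma fv_lplug L t z :
  z \in fv t -> (z \in fv (lplug L t)) || (z \in lcapt L).
Proof.
move=> tz; elim: L => [|v x L IH|m x y L IH|m v x L IH|e x L IH] /=;
  rewrite ?tz // ?inE ?mem_cat ?inE !mem_unbind;
  move: IH; case: (z \in lcapt L); rewrite ?orbT // orbF => ->;
  case: (z == x); rewrite ?orbT //.
by case: (z == y); rewrite ?orbT.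
Qed.

Lemma plug_fv :
  (forall C t u, plug C t u ->
     forall z, z \in fv t -> (z \in fv u) || (z \in capt C)) /\
  (forall V t u, vplug V t u ->
     forall z, z \in fv t -> (z \in fv u) || (z \in vcapt V)).
Proof.
apply: plug_vplug_ind => /=.
- by [].
- move=> V x s t L v _ IH _ z /IH /orP[|->]; last by rewrite orbT.
  move=> zLv; apply/orP; left; apply: fv_lplug_sub zLv => y /= vy.
  by rewrite mem_cat vy.
- move=> m V x s t L v _ IH _ z /IH /orP[|->]; last by rewrite orbT.
  move=> zLv; apply/orP; left; apply: fv_lplug_sub zLv => y /= vy.
  by rewrite inE mem_cat vy orbT.
- move=> L C t u _ IH z /IH; rewrite mem_cat.
  by case/orP=> [/(fv_lplug L)/orP[]->|->]; rewrite ?orbT.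
- by move=> t z ->.
- by move=> C s t u _ IH z /IH /orP[]; rewrite mem_cat => ->; rewrite ?orbT.
- by move=> s C t u _ IH z /IH /orP[]; rewrite mem_cat => ->; rewrite ?orbT.
- move=> x C t u _ IH z /IH; rewrite mem_unbind inE.
  by case: (z == x); rewrite ?orbT.
- by [].
Qed.

(** * Renaming and substitution do not raise the cost *)

Section Substitution.
(* [x] is replaced by an object with free variables [wf], bound variables [wb] *)
(* and denotation [d] in [r0].                                                 *)
Variables (x : var) (wf wb : seq var) (r0 : env) (d : den).

(** Invariant for evaluating a substituted term in [r] against the original in [r']. The first two
    clauses exclude capture; [wb] matters because substituting into a dereliction puts its body
    under the left context of the substituted bang. The last two say that a copy met inside the term
    is worth no more than the object in [r0], whose tree [d] was charged to [x]. *)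
Definition subst_ok (fvt bvt : seq var) (r r' : env) : Prop :=
  [/\ {in bvt, forall z, [&& z != x, z \notin wf & z \notin wb]},
      {in wb, forall z, z \notin fvt},
      {in fvt, forall z, z != x -> dle (r z) (r' z)},
      {in wf, forall z, dle (r z) (r0 z)}
    & dle d (r' x)].

Lemma subst_ok_sub fvt bvt fvt' bvt' r r' :
  {subset fvt' <= fvt} -> {subset bvt' <= bvt} ->
  subst_ok fvt bvt r r' -> subst_ok fvt' bvt' r r'.
Proof.
move=> fvS bvS [okb okf le_r le_wf le_d]; split=> // z.
- by move/bvS/okb.
- by move/okf; apply: contra; apply: fvS.
- by move/fvS/le_r.
Qed.

Lemma subst_ok_bind y fvt bvt r r' d1 d2 :
  dle d1 d2 -> subst_ok (unbind y fvt) (y :: bvt) r r' ->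
  subst_ok fvt bvt (upd r y d1) (upd r' y d2).
Proof.
move=> le_d12 [okb okf le_r le_wf le_d].
have /and3P[yx ywf ywb] := okb y (mem_head _ _).
split=> [z zb|z zwb|z zt zx|z zwf|].
- by apply: okb; rewrite inE zb orbT.
- have := okf z zwb; rewrite mem_unbind negb_and negbK => /orP[/eqP zy|//].
  by rewrite -zy zwb in ywb.
- by apply: dle_upd => // zy; apply: le_r; rewrite ?mem_unbind ?zy.
- rewrite /upd; case: eqP => [zy|_]; first by rewrite -zy zwf in ywf.
  exact: le_wf.
- by rewrite /upd eq_sym (negPf yx).
Qed.

Lemma subst_ok_bind_sub y fvt bvt fvt' bvt' r r' d1 d2 :
  {subset unbind y fvt' <= fvt} -> {subset y :: bvt' <= bvt} ->
  dle d1 d2 -> subst_ok fvt bvt r r' ->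
  subst_ok fvt' bvt' (upd r y d1) (upd r' y d2).
Proof. by move=> fvS bvS le_d ok; apply/subst_ok_bind/(subst_ok_sub fvS bvS). Qed.

Lemma subst_ok_bound y fvt bvt r r' :
  subst_ok fvt bvt r r' -> y \in bvt -> (y == x) = false.
Proof. by case=> okb _ _ _ _ /okb/and3P[/negPf]. Qed.

End Substitution.

Lemma mem_catl (s1 s2 : seq var) : {subset s1 <= s1 ++ s2}.
Proof. by move=> z zs; rewrite mem_cat zs. Qed.

Lemma mem_catr (s1 s2 : seq var) : {subset s2 <= s1 ++ s2}.
Proof. by move=> z zs; rewrite mem_cat zs orbT. Qed.

Lemma mem_consr (x : var) (s : seq var) : {subset s <= x :: s}.
Proof. by move=> z zs; rewrite inE zs orbT. Qed.

#[local] Hint Resolve mem_catl mem_catr mem_consr dle_refl : core.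

Lemma mren_mono n m r0 :
  let ok := subst_ok (MV m) [:: MV n] [::] r0 (r0 (MV n)) in
  (forall t r r', ok (fv t) (bv t) r r' ->
     rle 0 0 (ev (mren n m t) r) (ev t r')) /\
  (forall v r r', ok (fv_val v) (bv_val v) r r' ->
     rle 0 0 (ev_val (mren_val n m v) r) (ev_val v r')) /\
  (forall v r r', ok (fv_mval v) (bv_mval v) r r' ->
     rle 0 0 (ev_mval (mren_mval n m v) r) (ev_mval v r')) /\
  (forall v r r', ok (fv_eval v) (bv_eval v) r r' ->
     rle 0 0 (ev_eval (mren_eval n m v) r) (ev_eval v r')).
Proof.
move=> ok.
have ok_var o fvt bvt r r' : ok fvt bvt r r' -> MV o \in fvt ->
    dle (r (MV (mren_var n m o))) (r' (MV o)).
  case=> _ _ le_r le_n le_m o_fv; rewrite /mren_var; case: eqP => [->|/eqP om].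
    by move=> p; apply: leq_trans (le_m p); apply: le_n; rewrite inE.
  exact: le_r.
apply: term_value_ind => [v IHv|v IHv x t IHt|o x y t IHt|o v IHv x t IHt
  |e x t IHt|v IHv|v IHv|o|t IHt s IHs|x t IHt|e|t IHt] r r' rr /=.
- exact: IHv.
- rewrite (subst_ok_bound rr); last by rewrite /= mem_cat inE eqxx orbT.
  have [/= le1 le2] := IHv r r' (subst_ok_sub (@mem_catl _ _) (@mem_catl _ _) rr).
  have [|/= le3 le4] := IHt (upd r x (ev_val (mren_val n m v) r).2)
                            (upd r' x (ev_val v r').2).
    exact: subst_ok_bind_sub (@mem_catr _ _) (@mem_catr _ _) le2 rr.
  by split=> //=; lia.
- rewrite !(subst_ok_bound rr) ?inE ?eqxx ?orbT //=.
  have le_o c : dle (dproj c (r (MV (mren_var n m o)))) (dproj c (r' (MV o))).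
    by apply/dle_dproj/(ok_var _ _ _ _ _ rr)/mem_head.
  set ry := upd (upd _ _ _) _ _; set ry' := upd (upd _ _ (dproj true (r' _))) _ _.
  have [|/= le1 le2] := IHt ry ry'; last by split=> //=; lia.
  apply: subst_ok_bind => //.
  exact: subst_ok_bind_sub (@mem_consr _ _) (fun=> id) (le_o true) rr.
- rewrite (subst_ok_bound rr); last by rewrite /= mem_cat inE eqxx orbT.
  have [|/= le1 le2] := IHv r r'.
    by apply: subst_ok_sub rr => //= z zv; rewrite inE mem_cat zv orbT.
  have [|/= le3 le4] := IHt (upd r x den0) (upd r' x den0).
    by apply: subst_ok_bind_sub rr => //= z zv; rewrite inE mem_cat zv !orbT.
  by split=> //=; lia.
- rewrite (subst_ok_bound rr) ?inE ?eqxx //.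
  have le_e : dle (r (EV e)) (r' (EV e)).
    by case: rr => _ _ le_r _ _; apply: le_r; rewrite ?inE ?eqxx.
  have [|/= le3 le4] := IHt (upd r x (dproj true (r (EV e))))
                            (upd r' x (dproj true (r' (EV e)))).
    exact: subst_ok_bind_sub (@mem_consr _ _) (fun=> id) (dle_dproj _ le_e) rr.
  by split=> //=; have := le_e [::]; lia.
- exact: IHv.
- exact: IHv.
- by split=> //=; apply: ok_var rr _; rewrite inE.
- have [/= le1 le2] := IHt r r' (subst_ok_sub (@mem_catl _ _) (@mem_catl _ _) rr).
  have [/= le3 le4] := IHs r r' (subst_ok_sub (@mem_catr _ _) (@mem_catr _ _) rr).
  by split=> /=; [lia | apply: dle_dnode].
- rewrite (subst_ok_bound rr) ?inE ?eqxx //.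
  have [|/= le1 _] := IHt (upd r x den0) (upd r' x den0).
    exact: subst_ok_bind rr.
  by split=> //=; lia.
- have le_e : dle (r (EV e)) (r' (EV e)).
    by case: rr => _ _ le_r _ _; apply: le_r; rewrite ?inE ?eqxx.
  split=> /=; first by have := le_e [::]; lia.
  by apply: dle_dnode; [exact: le_e | exact: dle_dproj..].
- have [/= le1 le2] := IHt r r' rr.
  by split=> /=; [lia | apply: dle_dnode => //; lia].
Qed.

Lemma lcapt_sub_bv L (v : value) : {subset lcapt L <= bv (lplug L v)}.
Proof.
by have [s Ls ->] := bv_lplug L; move=> z /Ls zs; rewrite mem_cat zs.
Qed.

(** A cut pushed into the left context of [lplug L v] is charged like a cut on that whole term,
    except that its body also sees the binders of [L]. *)
Lemma ev_lplug_cut L (v : value) x t r :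
  ev (lplug L (Cut v x t)) r =
  let a := ev (lplug L v) r in
  let b := ev t (upd (lenv L r) x a.2) in ((a.1 + b.1).+1, b.2).
Proof. by rewrite !ev_lplug /= addnS addnA. Qed.

(** Treats both clauses of substitution on a dereliction at once: [rho] is [r] for a variable and
    the environment at the hole of [L] for a bang. The bound is the cost of a dereliction on a
    variable denoting the tree of [w]. *)
Lemma ev_esubst_der w x t r :
  exists2 rho, (forall z, z \notin bv_eval w -> rho z = r z) &
    rle 0 0 (ev (esubst_der w x t) r)
      (let b := ev t (upd rho x (dproj true (ev_eval w r).2)) in
       (((ev_eval w r).1 + b.1).+1, b.2)).
Proof.
case: w => [f|s] /=; first by exists r => //; split=> //=; lia.
have := lsplitK s; case: (lsplit s) => L v /= <-.
exists (lenv L r) => [z zs|].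
  by apply: lenv_notin; apply: contra zs; apply: lcapt_sub_bv.
by rewrite ev_lplug_cut; split=> //=; lia.
Qed.

(** Every copy of [w] is paid by the root label charged where [e] was used. The inequality is not
    strict, since [e] need not occur; the strict drop of ess comes from the erased cut. *)
Lemma esubst_mono w e r0 :
  {in bv_eval w, forall z, z \notin fv_eval w} ->
  let ok := subst_ok (EV e) (fv_eval w) (bv_eval w) r0 (ev_eval w r0).2 in
  (forall t r r', ok (fv t) (bv t) r r' ->
     rle 0 0 (ev (esubst w e t) r) (ev t r')) /\
  (forall v r r', ok (fv_val v) (bv_val v) r r' ->
     rle 0 0 (ev_val (esubst_val w e v) r) (ev_val v r')) /\
  (forall v r r', ok (fv_mval v) (bv_mval v) r r' ->
     rle 0 0 (ev_mval (esubst_mval w e v) r) (ev_mval v r')) /\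
  (forall v r r', ok (fv_eval v) (bv_eval v) r r' ->
     rle 0 0 (ev_eval (esubst_eval w e v) r) (ev_eval v r')).
Proof.
move=> fresh_w ok.
have ok_w fvt bvt r r' : ok fvt bvt r r' ->
    rle 0 0 (ev_eval w r) (ev_eval w r0).
  by case=> _ _ _ le_w _; apply: ev_mono.2.2.2.
apply: term_value_ind => [v IHv|v IHv x t IHt|o x y t IHt|o v IHv x t IHt
  |f x t IHt|v IHv|v IHv|o|t IHt s IHs|x t IHt|f|t IHt] r r' rr /=.
- exact: IHv.
- rewrite (subst_ok_bound rr); last by rewrite /= mem_cat inE eqxx orbT.
  have [/= le1 le2] := IHv r r' (subst_ok_sub (@mem_catl _ _) (@mem_catl _ _) rr).
  have [|/= le3 le4] := IHt (upd r x (ev_val (esubst_val w e v) r).2)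
                            (upd r' x (ev_val v r').2).
    exact: subst_ok_bind_sub (@mem_catr _ _) (@mem_catr _ _) le2 rr.
  by split=> //=; lia.
- rewrite !(subst_ok_bound rr) ?inE ?eqxx ?orbT //=.
  have le_o c : dle (dproj c (r (MV o))) (dproj c (r' (MV o))).
    apply/dle_dproj; case: rr => _ _ le_r _ _.
    by apply: le_r; rewrite ?inE ?eqxx.
  set ry := upd (upd _ _ _) _ _; set ry' := upd (upd _ _ (dproj true (r' _))) _ _.
  have [|/= le1 le2] := IHt ry ry'; last by split=> //=; lia.
  apply: subst_ok_bind => //.
  exact: subst_ok_bind_sub (@mem_consr _ _) (fun=> id) (le_o true) rr.
- rewrite (subst_ok_bound rr); last by rewrite /= mem_cat inE eqxx orbT.
  have [|/= le1 le2] := IHv r r'.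
    by apply: subst_ok_sub rr => //= z zv; rewrite inE mem_cat zv orbT.
  have [|/= le3 le4] := IHt (upd r x den0) (upd r' x den0).
    by apply: subst_ok_bind_sub rr => //= z zv; rewrite inE mem_cat zv !orbT.
  by split=> //=; lia.
- rewrite (subst_ok_bound rr) ?inE ?eqxx //.
  case: eqP => [fe|/eqP fe]; last first.
    have le_f : dle (r (EV f)) (r' (EV f)).
      by case: rr => _ _ le_r _ _; apply: le_r; rewrite ?inE ?eqxx.
    have [|/= le3 le4] := IHt (upd r x (dproj true (r (EV f))))
                              (upd r' x (dproj true (r' (EV f)))).
      exact: subst_ok_bind_sub (@mem_consr _ _) (fun=> id) (dle_dproj _ le_f) rr.
    by split=> //=; have := le_f [::]; lia.
  subst f; have [le1 le2] := ok_w _ _ _ _ rr.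
  have [rho rhoE [/= le3 le4]] := ev_esubst_der w x (esubst w e t) r.
  have [okb okf le_r le_w le_e] := rr.
  have /and3P[_ xw xwb] := okb x (mem_head _ _).
  have := le_e [::]; rewrite ev_eval_cost => le_k.
  have [|/= le5 le6] := IHt (upd rho x (dproj true (ev_eval w r).2))
                            (upd r' x (dproj true (r' (EV e)))).
    apply: (subst_ok_bind_sub (@mem_consr (EV e) _) (fun=> id)).
      by move=> p; apply: leq_trans (le2 _) (le_e _).
    (* [rho] may differ from [r] only on binders of [w], which are free neither in the dereliction
       nor in [w], so the invariant survives. *)
    split=> [|z /okf|z zt ze|z zw|] //.
      by rewrite rhoE; [exact: le_r | apply: contraL zt; apply: okf].
    by rewrite rhoE; [exact: le_w | apply: contraL zw; apply: fresh_w].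
  split=> /=; first by lia.
  by move=> p; apply: leq_trans (le4 p) (le6 p).
- exact: IHv.
- exact: IHv.
- split=> //=; case: rr => _ _ le_r _ _.
  by apply: le_r; rewrite ?inE ?eqxx.
- have [/= le1 le2] := IHt r r' (subst_ok_sub (@mem_catl _ _) (@mem_catl _ _) rr).
  have [/= le3 le4] := IHs r r' (subst_ok_sub (@mem_catr _ _) (@mem_catr _ _) rr).
  by split=> /=; [lia | apply: dle_dnode].
- rewrite (subst_ok_bound rr) ?inE ?eqxx //.
  have [|/= le1 _] := IHt (upd r x den0) (upd r' x den0).
    exact: subst_ok_bind rr.
  by split=> //=; lia.
- case: eqP => [->|/eqP fe].
    have [le1 le2] := ok_w _ _ _ _ rr.
    have [okb okf le_r le_w le_e] := rr.
    have := le_e [::]; rewrite ev_eval_cost => le_k.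
    split=> /=; first by lia.
    move=> p; apply: leq_trans (le2 p) _; apply: leq_trans (le_e p) _.
    by case: p => [|[]] //=.
  have le_f : dle (r (EV f)) (r' (EV f)).
    by case: rr => _ _ le_r _ _; apply: le_r; rewrite ?inE ?eqxx.
  split=> /=; first by have := le_f [::]; lia.
  by apply: dle_dnode; [exact: le_f | exact: dle_dproj..].
- have [/= le1 le2] := IHt r r' rr.
  by split=> /=; [lia | apply: dle_dnode => //; lia].
Qed.

(** * Well-named redexes and closure under contexts *)

Lemma well_named_cut v x t :
  well_named (Cut v x t) ->
  [/\ {in bv_val v, forall z, [/\ z \notin fv_val v, z \notin fv t,
         z \notin bv t & z != x]},
      {in x :: bv t, forall z, z \notin fv_val v} & x \notin bv t].
Proof.
case/andP=> /=; rewrite cat_uniq cons_uniq => /and4P[_ /hasPn dis xt _] /fresh_forP fr.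
split=> // [z zv|z zt]; last first.
  by have := fr z; rewrite !mem_cat zt orbT negb_or => /(_ isT)/andP[].
have := fr z; rewrite !mem_cat zv mem_unbind negb_or => /(_ isT)/andP[zfv].
have := contraL (dis z) zv; rewrite inE negb_or => /andP[zx ztb].
by rewrite zx /= => zft; split.
Qed.

Lemma plug_well_named C t u :
  plug C t u -> well_named u ->
  well_named t /\ {in capt C, forall z, z \notin bv t}.
Proof.
move=> Ct /andP[uniq_u /fresh_forP fresh_u].
have [s Cs eq_u] := plug_bv.1 _ _ _ Ct.
move: uniq_u; rewrite (perm_uniq eq_u) cat_uniq => /and3P[_ /hasPn dis uniq_t].
have disC : {in capt C, forall z, z \notin bv t}.
  by move=> z /Cs zs; apply: contraL zs; apply: dis.
split=> //; rewrite /well_named uniq_t; apply/fresh_forP=> z zt.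
apply/negP=> /(plug_fv.1 _ _ _ Ct)/orP[|/disC]; last by rewrite zt.
by apply/negP/fresh_u; rewrite (perm_mem eq_u) mem_cat zt orbT.
Qed.

Lemma plug_capt_bv C t u : plug C t u -> {subset capt C <= bv u}.
Proof.
move=> /(plug_bv.1 _ _ _)[s Cs eq_u] z /Cs zs.
by rewrite (perm_mem eq_u) mem_cat zs.
Qed.

(** Two environments are needed because, below a cut on the path to the redex, the step may already
    have lowered the tree of the cut variable. *)
Definition cost_decreasing (root : term -> term -> Prop) : Prop :=
  forall t u, root t u -> well_named t ->
  forall r' r, (forall z, dle (r' z) (r z)) -> {in bv t, forall z, r z = den0} ->
  rle 1 0 (ev u r') (ev t r).

Lemma closure_cost root :
  cost_decreasing root ->
  forall t u, Defs.closure root t u -> (ev u env0).1 < (ev t env0).1.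
Proof.
move=> dec; apply: (@closure_measure (fun t => (ev t env0).1)) => [t u tu|].
  by congr _.1; apply: ev_aeq.1 tu _.
move=> C t u t0 u0 wn_t0 tu Ct Cu.
have [wn_t dis] := plug_well_named Ct wn_t0.
(* The context rebinds no binder of the redex, so these keep the zero tree of [env0]. The offsets
   [1] and [0] allow the context to cross a bang. *)
have [|le1 _] := (@ev_plug_mono [pred z | z \in bv t] env0 env0 1 0 u t _).1
  _ _ _ (orbT _) dis Cu Ct env0 env0 (env_rel_refl _ (fun z => dle_refl (env0 z))); last by lia.
by move=> r' r [le_r eq_r]; apply: dec => // z /eq_r[].
Qed.

Lemma dle_upd_den0 r' r x d :
  (forall z, dle (r' z) (r z)) -> r x = den0 -> forall z, dle (r' z) (upd r x d z).
Proof.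
move=> le_r rx z; rewrite /upd; case: eqP => // -> p.
by apply: leq_trans (le_r x p) _; rewrite rx.
Qed.

(** * Each root rule other than lolli lowers the cost *)

Lemma axm1_cost : cost_decreasing root_axm1.
Proof.
move=> _ _ [v m M t u MM [cm Mt] [cv Mu]] wn r' r le_r r0.
have [_ mv _] := well_named_cut wn.
have rm : r (MV m) = den0 by apply: r0; rewrite /= mem_cat inE eqxx orbT.
(* The second offset is the cost of [v], which moves from the cut into the hole; the first is the
   variable lost there. *)
have [|||/= le1 le2] := (@ev_plug_mono [pred z | z \in MV m :: fv v] r'
  (upd r (MV m) (ev_mval v r).2) 1 (ev_mval v r).1 v (MVar m) _).1 M u t _ _
  Mu Mt _ _ (env_rel_refl _ (dle_upd_den0 _ le_r rm)).
- move=> s' s [le_s eq_s].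
  have [/= le1 le2] : rle 0 0 (ev_mval v s') (ev_mval v r).
    apply: ev_mono.2.2.1 => z zv.
    by have [|-> _] := eq_s z; rewrite /= ?inE ?zv ?orbT.
  have [|_ sm] := eq_s (MV m); first by rewrite /= inE eqxx.
  by rewrite /upd eqxx in sm; rewrite /= sm; split=> //=; lia.
- by rewrite MM.
- move=> z zM; rewrite /= inE negb_or; apply/andP; split.
    by have /fresh_forP/(_ z zM) := cm; rewrite inE.
  by have /fresh_forP/(_ z zM) := cv.
- by split=> //=; lia.
Qed.

Lemma axm2_cost : cost_decreasing root_axm2.
Proof.
move=> _ _ [n m t] /well_named_cut[/= _ nt mt] r' r le_r r0.
have [|le1 le2] := (mren_mono n m r).1 t r' (upd r (MV m) (r (MV n))); last first.
  by split=> //=; lia.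
split=> //= [z zt|z _ zm|]; last by rewrite /upd eqxx.
- have := nt z; rewrite !inE zt orbT andbT => /(_ isT) ->; rewrite andbT.
  by apply: contraNneq mt => <-.
- by rewrite /upd (negPf zm).
Qed.

Lemma tensor_cost : cost_decreasing root_tensor.
Proof.
move=> _ _ [L v L' v' m M x y t q q' MM mM Mq Mq'] wn r' r le_r r0.
have [/= bv_p fv_p mq] := well_named_cut wn.
have rm : r (MV m) = den0 by apply: r0; rewrite /= mem_cat inE eqxx orbT.
set s := lplug L v in wn bv_p fv_p r0 *; set s' := lplug L' v' in wn bv_p fv_p r0 *.
set p := ev_mval (Pair s s') r.
have [bs Ms eq_q] := plug_bv.1 _ _ _ Mq.
have bq z : z \in capt M ++ bv (Par m x y t) -> z \in bv q.
  by rewrite (perm_mem eq_q) !mem_cat => /orP[/Ms->|->]; rewrite ?orbT.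
(* The second offset is the cost of the pair. With the par it pays exactly for the two new cuts, so
   the strict drop is the outer cut. *)
have [|||/= le1 le2] := (@ev_plug_mono [pred z | z \in MV m :: fv s ++ fv s'] r'
  (upd r (MV m) p.2) 0 ((ev s r).1 + (ev s' r).1).+1 _ _ _).1 M q' q _ _
  Mq' Mq _ _ (env_rel_refl _ (dle_upd_den0 _ le_r rm)).
- move=> f' f [le_f eq_f].
  have fm : f (MV m) = p.2.
    by have [|_ ->] := eq_f (MV m); rewrite /= ?inE /upd eqxx.
  have f's z : z \in fv s ++ fv s' -> dle (f' z) (r z).
    by move=> zs; have [|-> _] := eq_f z; rewrite //= inE zs orbT.
  have [/= le1 le2] : rle 0 0 (ev s f') (ev s r).
    by apply: ev_mono.1 => z zs; apply: f's; rewrite mem_cat zs.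
  rewrite ev_lplug_cut -/s /= ev_lplug_cut -/s' fm /=.
  set d := (ev s f').2; set f1 := upd (lenv L f') x d.
  (* The left contexts of [s] and [s'] now enclose other subterms; their binders avoid every
     variable those subterms read from outside. *)
  have notL z : z \in bv s -> [/\ z \notin fv s', z \notin bv q & z \notin fv q].
    move=> zs; have [] := bv_p z; first by rewrite mem_cat zs.
    by rewrite mem_cat negb_or => /andP[_ ->].
  have notL' z : z \in bv s' -> z \notin bv q /\ z \notin fv q.
    by move=> zs; have [] := bv_p z; first by rewrite mem_cat zs orbT.
  have [/= le3 le4] : rle 0 0 (ev s' f1) (ev s' r).
    apply: ev_mono.1 => z zs'; rewrite /f1 /upd; case: eqP => [zx|_].
      have := fv_p z; rewrite inE mem_cat zs' orbT bq ?orbT; first by move/(_ isT).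
      by rewrite zx mem_cat inE eqxx orbT.
    rewrite lenv_notin; first by apply: f's; rewrite mem_cat zs' orbT.
    by apply: contraL zs' => /lcapt_sub_bv/notL[].
  set f2 := upd (lenv L' f1) y _.
  set g := upd (upd f x _) y _.
  have [/= le5 le6] : rle 0 0 (ev t f2) (ev t g).
    apply: ev_mono.1 => z zt; apply: dle_upd => // zy.
    have zq : (z \in fv q) || (z \in bv q).
      have [zx|zx] := eqVneq z x; first by rewrite zx bq ?orbT // mem_cat inE eqxx orbT.
      have [|->//|zM] := orP (plug_fv.1 _ _ _ Mq z _).
        by rewrite /= inE !mem_unbind zx zy zt orbT.
      by rewrite bq ?orbT // mem_cat zM.
    rewrite lenv_notin; last first.
      by apply/negP=> /lcapt_sub_bv/notL'[/negPf zbq /negPf zfq]; rewrite zbq zfq in zq.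
    apply: dle_upd => // zx; rewrite lenv_notin //.
    by apply/negP=> /lcapt_sub_bv/notL[_ /negPf zbq /negPf zfq]; rewrite zbq zfq in zq.
  by split=> //=; lia.
- by rewrite MM.
- move=> z zM; rewrite /= inE negb_or; apply/andP; split.
    by apply: contraNneq mM => <-.
  by apply: fv_p; rewrite inE bq ?orbT // mem_cat zM.
- by split=> //=; lia.
Qed.

(** * Exponential root rules *)

Lemma axe1_cost : cost_decreasing root_axe1.
Proof.
move=> _ _ [w e C t u [ce Ct] [cw Cu]] wn r' r le_r r0.
have [_ ew _] := well_named_cut wn.
set R' := upd r' (EV e) (ev_eval w r').2; set R := upd r (EV e) (ev_eval w r).2.
have [le1 le2] : rle 0 0 (ev_eval w r') (ev_eval w r).
  by apply: ev_mono.2.2.2 => z _.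
have le_R z : dle (R' z) (R z) by apply: dle_upd.
have [|||/= le3 le4] := (@ev_plug_mono [pred z | z \in EV e :: fv w] R' R 1 0
  w (EVar e) _).1 C u t _ _ Cu Ct _ _ (env_rel_refl _ le_R).
- move=> s' s [le_s eq_s].
  have [/= le3 le4] : rle 0 0 (ev_eval w s') (ev_eval w r).
    apply: ev_mono.2.2.2 => z zw.
    have [|-> _] := eq_s z; first by rewrite /= inE zw orbT.
    rewrite /R' /upd; case: eqP => // ze.
    by have := ew z; rewrite ze inE eqxx -ze zw => /(_ isT).
  have [|_ ->] := eq_s (EV e); first by rewrite /= inE eqxx.
  rewrite /R /upd eqxx ev_eval_cost; split=> /=; first by lia.
  move=> p; apply: leq_trans (le4 p) _; case: p => [|[]] //=.
  by rewrite ev_eval_cost.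
- by rewrite orbT.
- move=> z zC; rewrite /= inE negb_or; apply/andP; split.
    by have /fresh_forP/(_ z zC) := ce; rewrite inE.
  by have /fresh_forP/(_ z zC) := cw.
- by split=> //=; rewrite -/R -/R'; lia.
Qed.

Lemma axe2_cost : cost_decreasing root_axe2.
Proof.
move=> _ _ [f e C x t q q' eC Cq Cq'] wn r' r le_r r0.
have [_ ef _] := well_named_cut wn.
set R' := upd r' (EV e) (ev_eval (EVar f) r').2.
set R := upd r (EV e) (ev_eval (EVar f) r).2.
have [le1 le2] : rle 0 0 (ev_eval (EVar f) r') (ev_eval (EVar f) r).
  by apply: ev_mono.2.2.2 => z _.
have le_R z : dle (R' z) (R z) by apply: dle_upd.
have [|||/= le3 le4] := (@ev_plug_mono [pred z | z \in [:: EV e; EV f]] R' R 1 0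
  _ _ _).1 C q' q _ _ Cq' Cq _ _ (env_rel_refl _ le_R).
- move=> s' s [le_s eq_s].
  have [|_ se] := eq_s (EV e); first by rewrite /= inE eqxx.
  have [|s'f _] := eq_s (EV f); first by rewrite /= !inE eqxx orbT.
  have {}s'f : s' (EV f) = r' (EV f).
    rewrite s'f /R' /upd; case: eqP => // fe.
    by have := ef (EV f); rewrite fe !inE eqxx -fe eqxx => /(_ isT).
  rewrite /R /upd eqxx in se; have le_f := le_r (EV f).
  have [/= le3 le4] : rle 0 0 (ev t (upd s' x (dproj true (s' (EV f)))))
                         (ev t (upd s x (dproj true (s (EV e))))).
    apply: ev_mono.1 => z _; apply: dle_upd => // p.
    by rewrite s'f se; apply: le_f.
  (* Through the cut, [e] carries the root label of [f] plus one, which is the unit gained. *)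
  by split=> //=; rewrite s'f se /= in le3 *; have := le_f [::]; lia.
- by rewrite orbT.
- move=> z zC; rewrite /= !inE negb_or; apply/andP; split.
    by apply: contraNneq eC => <-.
  by have := ef z; rewrite !inE (plug_capt_bv Cq zC) orbT; apply.
- by split=> //=; rewrite -/R -/R'; have := le_r (EV f) [::]; lia.
Qed.

Lemma bder_cost : cost_decreasing root_bder.
Proof.
move=> _ _ [L v e C x t q q' eC Cq Cq'] wn r' r le_r r0.
have [/= bv_s es _] := well_named_cut wn.
set s := lplug L v in wn bv_s es r0 *.
set R' := upd r' (EV e) (ev_eval (Bang s) r').2.
set R := upd r (EV e) (ev_eval (Bang s) r).2.
have [/= le1 le2] : rle 0 0 (ev_eval (Bang s) r') (ev_eval (Bang s) r).
  by apply: ev_mono.2.2.2 => z _.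
have le_R z : dle (R' z) (R z) by apply: dle_upd.
have [|||/= le3 le4] := (@ev_plug_mono [pred z | z \in EV e :: fv s] R' R 1 0
  _ _ _).1 C q' q _ _ Cq' Cq _ _ (env_rel_refl _ le_R).
- move=> f' f [le_f eq_f].
  have [|_ fe] := eq_f (EV e); first by rewrite /= inE eqxx.
  rewrite /R /upd eqxx /= in fe.
  have [/= le3 le4] : rle 0 0 (ev s f') (ev s r).
    apply: ev_mono.1 => z zs.
    have [|-> _] := eq_f z; first by rewrite /= inE zs orbT.
    rewrite /R' /upd; case: eqP => // ze.
    by have := es z; rewrite ze inE eqxx -ze zs => /(_ isT).
  (* The dereliction pays the cost of [Bang s], one more than the copy of [s] replacing it. *)
  rewrite ev_lplug_cut -/s /= fe /=.
  set f1 := upd _ x _; set f2 := upd f x _.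
  have [/= le5 le6] : rle 0 0 (ev t f1) (ev t f2).
    apply: ev_mono.1 => z zt; apply: dle_upd => // zx.
    rewrite lenv_notin //; apply/negP=> /lcapt_sub_bv/bv_s[_ zfq zbq _].
    have [|/(negP zfq)//|zC] := orP (plug_fv.1 _ _ _ Cq z _).
      by rewrite /= inE mem_unbind zx zt orbT.
    by rewrite (plug_capt_bv Cq zC) in zbq.
  by split=> //=; lia.
- by rewrite orbT.
- move=> z zC; rewrite /= inE negb_or; apply/andP; split.
    by apply: contraNneq eC => <-.
  by apply: es; rewrite inE (plug_capt_bv Cq zC) orbT.
- by split=> //=; rewrite -/R -/R'; lia.
Qed.

Lemma w_cost : cost_decreasing root_w.
Proof.
move=> _ _ [w e t et] _ r' r le_r _.
have [|/= le1 le2] := ev_mono.1 t r' (upd r (EV e) (ev_eval w r).2).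
  move=> z zt; rewrite /upd; case: eqP => [ze|//].
  by rewrite -ze zt in et.
by split=> //=; lia.
Qed.

Lemma ess_cost : cost_decreasing root_ess.
Proof.
move=> _ _ [w e t] /well_named_cut[/= bw fw et] r' r le_r _.
have [z /bw[]//||/= le1 le2] := (@esubst_mono w e r _).1 t r'
  (upd r (EV e) (ev_eval w r).2); last by split=> //=; lia.
split=> // [z zt|z /bw[]//|z _ ze|]; last by rewrite /upd eqxx.
- rewrite fw ?inE ?zt ?orbT //= andbC; apply/andP; split.
    by apply/negP=> /bw[_ _]; rewrite zt.
  by apply: contraNneq et => <-.
- by rewrite /upd (negPf ze).
Qed.

(** * Strong normalization of the five relations *)

Lemma nololli_cost t u :
  (to_ms_nololli \+r to_ss_nololli) t u -> (ev u env0).1 < (ev t env0).1.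
Proof.
case=> [[[[]|]|[[[]|]|]]|[[[]|]|]]; apply: closure_cost.
- exact: axm1_cost.
- exact: axm2_cost.
- exact: tensor_cost.
- exact: axe1_cost.
- exact: axe2_cost.
- exact: bder_cost.
- exact: w_cost.
- exact: axm1_cost.
- exact: axm2_cost.
- exact: tensor_cost.
- exact: ess_cost.
Qed.

Theorem theorem8p8 :
  forall a : term -> term -> Prop,
    a = to_m \/ a = to_ems \/ a = to_ess \/ a = to_ms_nololli \/ a = to_ss_nololli ->
  forall t : term, strongly_normalizing a t.
Proof.
move=> a [->|a_nololli]; first exact: measure_sn to_m_tsize.
(* The other four relations are all contained in the union of the two fragments without lolli. *)
apply: (@measure_sn (fun t => (ev t env0).1)) => t u tu; apply: nololli_cost.
move: a_nololli tu => [->|[->|[->|->]]] tu.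
- by left; right.
- by right; right.
- by left.
- by right.
Qed.
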